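(* Let $(\mathfrak{g},[\cdot,\cdot]_\mathfrak{g},N)$ be a Nijenhuis Lie algebra. Set $C^0_{\mathrm{NLie}}(\mathfrak{g},N)=0$, $C^1_{\mathrm{NLie}}(\mathfrak{g},N)=\mathrm{Hom}(\mathfrak{g},\mathfrak{g})$ and $C^n_{\mathrm{NLie}}(\mathfrak{g},N)=\mathrm{Hom}(\wedge^n\mathfrak{g},\mathfrak{g})\oplus\mathrm{Hom}(\wedge^{n-1}\mathfrak{g},\mathfrak{g})$ for $n\ge2$, and define $\delta_{\mathrm{NLie}}:C^n_{\mathrm{NLie}}(\mathfrak{g},N)\to C^{n+1}_{\mathrm{NLie}}(\mathfrak{g},N)$ by $$\delta_{\mathrm{NLie}}(f)=\big(\delta_{\mathrm{CE}}(f),-\partial^N(f)\big),\qquad \delta_{\mathrm{NLie}}(\chi,F)=\big(\delta_{\mathrm{CE}}(\chi),\,d_N(F)+(-1)^n\partial^N(\chi)\big),$$ for $f\in C^1_{\mathrm{NLie}}(\mathfrak{g},N)$ and $(\chi,F)\in C^{n}_{\mathrm{NLie}}(\mathfrak{g},N)$ with $n\ge2$. Then $\delta_{\mathrm{NLie}}$ is a differential, i.e. $(\delta_{\mathrm{NLie}})^2=0$.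
   Context: All vector spaces are over a fixed field. A Nijenhuis Lie algebra $(\mathfrak{g},[\cdot,\cdot]_\mathfrak{g},N)$ is a Lie algebra with a linear map $N:\mathfrak{g}\to\mathfrak{g}$ satisfying $[N(x),N(y)]_\mathfrak{g}=N\big([N(x),y]_\mathfrak{g}+[x,N(y)]_\mathfrak{g}-N[x,y]_\mathfrak{g}\big)$ for all $x,y$. For $f\in\mathrm{Hom}(\wedge^n\mathfrak{g},\mathfrak{g})$, $n\ge 1$: $$(\delta_{\mathrm{CE}}f)(x_1,\dots,x_{n+1})=\sum_i(-1)^{i+1}[x_i,f(\dots,\widehat{x_i},\dots)]_\mathfrak{g}+\sum_{i<j}(-1)^{i+j}f([x_i,x_j]_\mathfrak{g},\dots,\widehat{x_i},\dots,\widehat{x_j},\dots),$$ $$(d_Nf)(x_1,\dots,x_{n+1})=\sum_i(-1)^{i+1}[N(x_i),f(\dots,\widehat{x_i},\dots)]_\mathfrak{g}+\sum_{i<j}(-1)^{i+j}f([N(x_i),x_j]_\mathfrak{g}+[x_i,N(x_j)]_\mathfrak{g}-N[x_i,x_j]_\mathfrak{g},\dots,\widehat{x_i},\dots,\widehat{x_j},\dots)-N\big((\delta_{\mathrm{CE}}f)(x_1,\dots,x_{n+1})\big),$$ $$(\partial^Nf)(x_1,\dots,x_n)=\sum_{k=0}^n(-1)^kN^k\Big(\sum_{I\subseteq\{1,\dots,n\},\,|I|=k}f(y^I_1,\dots,y^I_n)\Big),\qquad y^I_i=x_i\text{ if }i\in I,\quad y^I_i=N(x_i)\text{ if }i\notin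 I.$$ *)

(* Defs.v *)
From HB Require Import structures.
From mathcomp Require Import all_boot all_order all_algebra.
From mathcomp Require Import perm all_classical zify.

Set Implicit Arguments.
Unset Strict Implicit.
Unset Printing Implicit Defensive.

Import GRing.Theory.
Local Open Scope ring_scope.

HB.mixin Record Lmodule_isLie (K : fieldType) g of GRing.Lmodule K g := {
  lie : g -> g -> g;
  lie_linearl : forall y : g, linear (fun x => lie x y);
  lie_linearr : forall x : g, linear (lie x);
  liexx : forall x : g, lie x x = 0;
  lie_jacobi : forall x y z : g,
    lie x (lie y z) + lie y (lie z x) + lie z (lie x y) = 0
}.

#[short(type="lieAlgType")]
HB.structure Definition LieAlgebra (K : fieldType) :=
  { g of Lmodule_isLie K g & GRing.Lmodule K g }.

Definition lie_deformed (K : fieldType) (g : lieAlgType K) (N : g -> g)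
    (x y : g) : g :=
  lie (N x) y + lie x (N y) - N (lie x y).

Definition nijenhuis (K : fieldType) (g : lieAlgType K) (N : g -> g) : Prop :=
  forall x y : g, lie (N x) (N y) = N (lie_deformed N x y).

Section AlternatingMaps.
Variables (K : fieldType) (V : lmodType K).

(* [eta x with i |-> v] is the family x with its i-th entry replaced by v. *)
Definition multilinear n (f : ('I_n -> V) -> V) : Prop :=
  forall (i : 'I_n) (x : 'I_n -> V), linear (fun v => f [eta x with i |-> v]).

Definition alternating n (f : ('I_n -> V) -> V) : Prop :=
  forall (x : 'I_n -> V) (i j : 'I_n), i != j -> x i = x j -> f x = 0.

Definition alt_pred n : {pred ('I_n -> V) -> V} :=
  fun f => `[< multilinear f /\ alternating f >].
Arguments alt_pred n : clear implicits.

Lemma alt_predP n (f : ('I_n -> V) -> V) :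
  reflect (multilinear f /\ alternating f) (f \in alt_pred n).
Proof. exact: asboolP. Qed.

Lemma alt_pred_submod n : submod_closed (@alt_pred n).
Proof.
split.
  by apply/alt_predP; split=> [i x a u v|x i j _ _] //=; rewrite scaler0 addr0.
move=> a u v /alt_predP[um ua] /alt_predP[vm va]; apply/alt_predP; split.
  move=> i x b w1 w2; rewrite !fctE um vm !scalerDr !scalerA mulrC -!addrA.
  by congr (_ + _); rewrite addrCA.
by move=> x i j ij xij; rewrite !fctE (ua _ _ _ ij xij) (va _ _ _ ij xij) scaler0 addr0.
Qed.

HB.instance Definition _ n :=
  GRing.isSubmodClosed.Build K (('I_n -> V) -> V) (@alt_pred n)
    (@alt_pred_submod n).

(* altHom n is Hom(wedge^n V, V), as alternating n-linear maps V^n -> V.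
   Alternating means vanishing when two arguments agree, so the definition is
   also the right one in characteristic 2. *)
Record altHom n := AltHom {
  alt_fun :> ('I_n -> V) -> V;
  alt_funP : alt_fun \in alt_pred n
}.

HB.instance Definition _ n := [isSub for @alt_fun n].
HB.instance Definition _ n := [Choice of altHom n by <:].
HB.instance Definition _ n := [SubChoice_isSubLmodule of altHom n by <:].

End AlternatingMaps.
Arguments alt_pred {K} V n _.

(* The sequence (a, y_0, ..., y_(n-1)). *)
Definition fcons (T : Type) n (a : T) (y : 'I_n -> T) : 'I_n.+1 -> T :=
  fun k => if unlift ord0 k is Some k' then y k' else a.

(* Indices start at 0, so the usual signs (-1)^(i+1) and (-1)^(i+j) become
   (-1)^i and (-1)^(i+j).  For i < j, the map lift j \o lift (inord i) is the
   increasing enumeration of the indices other than i and j. *)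
Definition ce_formula (K : fieldType) (V : lmodType K) (rho B : V -> V -> V)
    n (f : ('I_n.+1 -> V) -> V) (x : 'I_n.+2 -> V) : V :=
  \sum_(i < n.+2) (-1) ^+ i *: rho (x i) (f (fun k => x (lift i k)))
  + \sum_(i < n.+2) \sum_(j < n.+2 | (i < j)%N)
      (-1) ^+ (i + j) *:
        f (fcons (B (x i) (x j)) (fun k => x (lift j (lift (inord i) k)))).

Definition ce_fun (K : fieldType) (g : lieAlgType K) n (f : ('I_n.+1 -> g) -> g)
    : ('I_n.+2 -> g) -> g :=
  ce_formula lie lie f.

Definition dN_fun (K : fieldType) (g : lieAlgType K) (N : g -> g) n (f : ('I_n.+1 -> g) -> g) (x : 'I_n.+2 -> g) : g :=
  ce_formula (fun u v => lie (N u) v) (lie_deformed N) f x - N (ce_fun f x).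

Definition partialN_fun (K : fieldType) (V : lmodType K) (N : V -> V)
    n (f : ('I_n -> V) -> V) (x : 'I_n -> V) : V :=
  \sum_(0 <= k < n.+1) (-1) ^+ k *:
    iter k N (\sum_(I : {set 'I_n} | #|I| == k)
                f (fun i => if i \in I then x i else N (x i))).

Section Closure.
Variables (K : fieldType).

Lemma linear_zero (U V : lmodType K) : linear (fun _ : U => 0 : V).
Proof. by move=> a u v; rewrite scaler0 addr0. Qed.

Lemma linear_add (U V : lmodType K) (p q : U -> V) :
  linear p -> linear q -> linear (fun u => p u + q u).
Proof.
by move=> hp hq a u v; rewrite hp hq scalerDr !addrA; congr (_ + _); rewrite addrAC.
Qed.

Lemma linear_scale (U V : lmodType K) c (p : U -> V) :
  linear p -> linear (fun u => c *: p u).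
Proof. by move=> hp a u v; rewrite hp scalerDr !scalerA mulrC. Qed.

Lemma linear_sum (U V : lmodType K) I (r : seq I) (P : pred I) (F : I -> U -> V) :
  (forall i, P i -> linear (F i)) -> linear (fun u => \sum_(i <- r | P i) F i u).
Proof.
move=> hF a u v; rewrite scaler_sumr -big_split /=.
by apply: eq_bigr => i Pi; rewrite hF.
Qed.

Lemma linear_comp (U V W : lmodType K) (p : V -> W) (q : U -> V) :
  linear p -> linear q -> linear (fun u => p (q u)).
Proof. by move=> hp hq a u v; rewrite hq hp. Qed.

Lemma linear_map0 (U V : lmodType K) (p : U -> V) : linear p -> p 0 = 0.
Proof.
by move=> hp; have := hp (-1) 0 0; rewrite scaler0 addr0 scaleN1r addNr.
Qed.

Variables (V : lmodType K).

Lemma sum_pair0 (I : finType) (M : zmodType) (h : I -> M) (a b : I) :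
  a != b -> h a + h b = 0 -> (forall i, i != a -> i != b -> h i = 0) ->
  \sum_i h i = 0.
Proof.
move=> ab hab h0; rewrite (bigD1 a) //= (bigD1 b) 1?eq_sym //= addrA hab add0r.
by apply: big1 => i /andP[]; apply: h0.
Qed.

Lemma multilinear_swap n (f : ('I_n -> V) -> V) (b c : 'I_n) :
  multilinear f -> b != c -> (forall x, x b = x c -> f x = 0) ->
  forall x, f (fun k => x (tperm b c k)) = - f x.
Proof.
move=> fm /negbTE bc fbc x.
pose y u v : 'I_n -> V := [eta [eta x with b |-> v] with c |-> u].
have yc u v : y u v c = u by rewrite /y /= eqxx.
have yb u v : y u v b = v by rewrite /y /= bc eqxx.
have lin1 v : linear (fun u => f (y u v)) by exact: fm.
have lin2 u : linear (fun v => f (y u v)).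
  have -> : (fun v => f (y u v)) = (fun v => f [eta [eta x with c |-> u] with b |-> v]).
    apply/funext => v; congr (f _); apply/funext => k; rewrite /y /=.
    by case: (eqVneq k c) => [->|//]; rewrite eq_sym bc.
  exact: fm.
have add1 u u' v : f (y (u + u') v) = f (y u v) + f (y u' v).
  by have := lin1 v 1 u u'; rewrite !scale1r.
have add2 u v v' : f (y u (v + v')) = f (y u v) + f (y u v').
  by have := lin2 u 1 v v'; rewrite !scale1r.
have diag u : f (y u u) = 0 by apply: fbc; rewrite yc yb.
have yE : y (x c) (x b) = x.
  by apply/funext => k; rewrite /y /=; case: eqP => [->//|_]; case: eqP => [->|].
have yS : y (x b) (x c) = (fun k => x (tperm b c k)).
  apply/funext => k; rewrite /y /=; case: eqP => [->|/eqP kc]; first by rewrite tpermR.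
  case: eqP => [->|/eqP kb]; first by rewrite tpermL.
  by rewrite tpermD // eq_sym.
have := diag (x c + x b); rewrite add1 !add2 !diag addr0 add0r yE yS addrC.
by move/eqP; rewrite addr_eq0 => /eqP.
Qed.

Lemma alternating_adj n (f : ('I_n -> V) -> V) : multilinear f ->
  (forall (x : 'I_n -> V) (a b : 'I_n), val b = (val a).+1 -> x a = x b ->
     f x = 0) ->
  alternating f.
Proof.
move=> fm fadj.
suff H d : forall (x : 'I_n -> V) (a b : 'I_n), val b = (val a + d).+1 ->
    x a = x b -> f x = 0.
  move=> x i j ij xij; case: (ltngtP i j) => ltij.
  - by apply: (H (j - i.+1)%N x i j) => //; rewrite -addSn subnKC.
  - by apply: (H (i - j.+1)%N x j i) => //; rewrite -addSn subnKC.
  - by rewrite (val_inj ltij) eqxx in ij.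
elim: d => [|d IH] x a b bE xab; first by apply: (fadj x a b); rewrite // bE addn0.
have cn : ((val a + d).+1 < n)%N.
  by rewrite (leq_ltn_trans _ (ltn_ord b)) // bE addnS.
pose c : 'I_n := Ordinal cn.
have cb : val b = (val c).+1 by rewrite bE addnS.
have bc : b != c by apply/eqP => /(congr1 val); rewrite cb => /esym/n_Sn.
have ac : c != a by apply/eqP => /(congr1 val) /=; lia.
have ab : b != a by apply/eqP => /(congr1 val); rewrite bE /=; lia.
apply: oppr_inj; rewrite oppr0.
rewrite -(multilinear_swap fm bc) => [|y ybc]; last exact: (fadj y c b).
by apply: (IH _ a c) => //; rewrite tpermD // tpermR.
Qed.

Lemma fcons0 n (a : V) (y : 'I_n -> V) : fcons a y ord0 = a.
Proof. by rewrite /fcons unlift_none. Qed.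

Lemma fconsS n (a : V) (y : 'I_n -> V) k : fcons a y (lift ord0 k) = y k.
Proof. by rewrite /fcons liftK. Qed.

Lemma fcons_upd n (a v : V) (y : 'I_n -> V) s :
  fcons a [eta y with s |-> v] = [eta fcons a y with lift ord0 s |-> v].
Proof.
apply/funext => k /=; case: (unliftP ord0 k) => [k' ->|->].
  by rewrite !fconsS /= (inj_eq lift_inj).
by rewrite !fcons0 (negbTE (neq_lift _ _)).
Qed.

Lemma fcons_upd0 n (v : V) (y : 'I_n -> V) :
  fcons v y = [eta fcons 0 y with ord0 |-> v].
Proof.
apply/funext => k /=; case: (unliftP ord0 k) => [k' ->|->].
  by rewrite !fconsS eq_sym (negbTE (neq_lift _ _)).
by rewrite !fcons0 eqxx.
Qed.

Lemma lift_lift_surj n (i j k : 'I_n.+2) : (i < j)%N -> k != i -> k != j ->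
  exists s : 'I_n, k = lift j (lift (inord i) s).
Proof.
move=> ij ki kj; have iE : lift j (inord i) = i.
  apply: val_inj => /=; rewrite /bump inordK; last by have := ltn_ord j; lia.
  by rewrite leqNgt ij.
case: (unliftP j k) kj => [k' kE _|->]; last by rewrite eqxx.
case: (unliftP (inord i) k') => [s sE|k'E]; first by exists s; rewrite kE sE.
by rewrite kE k'E iE eqxx in ki.
Qed.

Lemma lift_lift_inj n (i j : 'I_n.+2) : injective (fun s : 'I_n => lift j (lift (inord i) s)).
Proof. by move=> s t /lift_inj/lift_inj. Qed.

Lemma lift_lift_neq n (i j : 'I_n.+2) (s : 'I_n) : (i < j)%N ->
  lift j (lift (inord i) s) != i /\ lift j (lift (inord i) s) != j.
Proof.
move=> ij; split; last by rewrite eq_sym neq_lift.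
have iE : lift j (inord i) = i.
  apply: val_inj => /=; rewrite /bump inordK; last by have := ltn_ord j; lia.
  by rewrite leqNgt ij.
by rewrite -[X in _ != X]iE (inj_eq lift_inj) eq_sym neq_lift.
Qed.

Section CE.
Variables (rho B : V -> V -> V).
Hypothesis rhol : forall y, linear (rho^~ y).
Hypothesis rhor : forall x, linear (rho x).
Hypothesis Bl : forall y, linear (B^~ y).
Hypothesis Br : forall x, linear (B x).
Hypothesis Bxx : forall x, B x x = 0.

Lemma ce_multilinear n (f : ('I_n.+1 -> V) -> V) :
  multilinear f -> multilinear (ce_formula rho B f).
Proof.
move=> fm s x; apply: linear_add; apply: linear_sum => i _.
  apply: linear_scale => /=; case: (unliftP i s) => [s' sE|->].
    have is_ : (i == s) = false by rewrite sE (negbTE (neq_lift _ _)).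
    rewrite is_; apply: linear_comp; first exact: rhor.
    have -> : (fun v => f (fun k => if lift i k == s then v else x (lift i k)))
        = (fun v => f [eta (fun k => x (lift i k)) with s' |-> v]).
      by apply/funext => v; congr (f _); apply/funext => k; rewrite sE /= (inj_eq lift_inj).
    exact: fm.
  rewrite eqxx.
  have -> : (fun v => rho v (f (fun k => if lift i k == i then v else x (lift i k))))
      = (rho^~ (f (fun k => x (lift i k)))).
    apply/funext => v; congr (rho _ (f _)); apply/funext => k.
    by rewrite eq_sym (negbTE (neq_lift _ _)).
  exact: rhol.
apply: linear_sum => j ij; apply: linear_scale => /=.
have ijF : (i == j) = false by apply/negbTE; rewrite neq_ltn ij.
case: (eqVneq s i) => [->|si].
  rewrite ?eqxx [j == i]eq_sym ijF.
  have -> : (fun v => f (fcons (B v (x j)) (fun k => if lift j (lift (inord i) k) == i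
        then v else x (lift j (lift (inord i) k))))) =
      (fun v => f [eta fcons 0 (fun k => x (lift j (lift (inord i) k))) with ord0 |-> B v (x j)]).
    apply/funext => v; rewrite -fcons_upd0; congr (f (fcons _ _)); apply/funext => k.
    by case: (lift_lift_neq k ij) => /negbTE ->.
  exact: (@linear_comp _ _ _ (fun w => f [eta fcons 0 _ with ord0 |-> w])
    (B^~ (x j)) (fm _ _) (Bl _)).
case: (eqVneq s j) => [->|sj].
  rewrite ?ijF.
  have -> : (fun v => f (fcons (B (x i) v) (fun k => if lift j (lift (inord i) k) == j
        then v else x (lift j (lift (inord i) k))))) =
      (fun v => f [eta fcons 0 (fun k => x (lift j (lift (inord i) k))) with ord0 |-> B (x i) v]).
    apply/funext => v; rewrite -fcons_upd0; congr (f (fcons _ _)); apply/funext => k.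
    by case: (lift_lift_neq k ij) => _ /negbTE ->.
  exact: (@linear_comp _ _ _ (fun w => f [eta fcons 0 _ with ord0 |-> w])
    (B (x i)) (fm _ _) (Br _)).
rewrite ?[i == s]eq_sym ?(negbTE si) ?[j == s]eq_sym ?(negbTE sj).
have [t tE] := lift_lift_surj ij si sj.
have -> : (fun v => f (fcons (B (x i) (x j)) (fun k => if lift j (lift (inord i) k) == s
        then v else x (lift j (lift (inord i) k))))) =
    (fun v => f [eta fcons (B (x i) (x j)) (fun k => x (lift j (lift (inord i) k)))
               with lift ord0 t |-> v]).
  apply/funext => v; rewrite -fcons_upd; congr (f (fcons _ _)); apply/funext => k.
  by rewrite tE /= (inj_eq (@lift_lift_inj _ i j)).
exact: fm.
Qed.

Lemma ce_alternating n (f : ('I_n.+1 -> V) -> V) :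
  multilinear f -> alternating f -> alternating (ce_formula rho B f).
Proof.
move=> fm fa; apply: alternating_adj; first exact: ce_multilinear.
move=> x a b bE xab.
have abN : a != b by apply/eqP => /(congr1 val); rewrite bE => /n_Sn.
have B0 y : B y 0 = 0 by exact: linear_map0.
have f0 y : f (fcons 0 y) = 0.
  by rewrite fcons_upd0; exact: (linear_map0 (fm ord0 _)).
have -> : ce_formula rho B f x =
    \sum_(i < n.+2) (-1) ^+ i *: rho (x i) (f (fun k => x (lift i k))) +
    \sum_(i < n.+2) \sum_(j < n.+2) (if (i < j)%N then
      (-1) ^+ (i + j) *:
        f (fcons (B (x i) (x j)) (fun k => x (lift j (lift (inord i) k)))) else 0).
  by congr (_ + _); apply: eq_bigr => i _; rewrite big_mkcond.
rewrite (sum_pair0 abN) ?add0r.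
- pose T (i j : 'I_n.+2) := if (i < j)%N then (-1) ^+ (i + j) *:
      f (fcons (B (x i) (x j)) (fun k => x (lift j (lift (inord i) k)))) else 0.
  change (\sum_i \sum_j T i j = 0).
  have T1 i j : i != a -> i != b -> j != a -> j != b -> T i j = 0.
    move=> ia ib ja jb; rewrite /T; case: ifP => // ij.
    have [s sE] : exists s : 'I_n, a = lift j (lift (inord i) s).
      by apply: lift_lift_surj => //; rewrite eq_sym.
    have [t tE] : exists t : 'I_n, b = lift j (lift (inord i) t).
      by apply: lift_lift_surj => //; rewrite eq_sym.
    rewrite (fa _ (lift ord0 s) (lift ord0 t)) ?scaler0 //.
      by rewrite (inj_eq lift_inj); apply: contra_neq abN => st; rewrite sE st -tE.
    by rewrite !fconsS -sE -tE.
  have Taa i : T i i = 0 by rewrite /T ltnn.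
  have Tab : T a b = 0 by rewrite /T bE ltnSn xab Bxx f0 scaler0.
  have Tba : T b a = 0 by rewrite /T bE ltnNge leqnSn.
  have Tl j : j != a -> j != b -> T a j + T b j = 0.
    move=> ja jb; rewrite /T bE xab.
    have jaN : val j <> val a by move=> /val_inj je; rewrite je eqxx in ja.
    have jbN : val j <> (val a).+1.
      by rewrite -bE => /val_inj je; rewrite je eqxx in jb.
    case: ifP => aj; last first.
      by rewrite ifF ?addr0 //; move: aj jaN; rewrite /=; lia.
    have aj1 : ((val a).+1 < j)%N by move: aj jbN => /=; lia.
    rewrite aj1 addSn exprS mulN1r scaleNr; apply/eqP; rewrite subr_eq0; apply/eqP.
    congr (_ *: f (fcons _ _)); apply/funext => k.
    case: (eqVneq (val k) (val a)) => ka; last first.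
      congr (x (lift j _)); apply: val_inj; rewrite /= /bump !inordK ?bE; last 2 first.
      - by have := ltn_ord j; move: aj1 => /=; lia.
      - by have := ltn_ord j; move: aj1 => /=; lia.
      by move: ka => /=; lia.
    transitivity (x b); [|rewrite -xab]; congr (x _); apply: val_inj;
      rewrite /= /bump !inordK ?bE /=; have := ltn_ord j; move: ka aj1 => /=; lia.
  have Tr i : i != a -> i != b -> T i a + T i b = 0.
    move=> ia ib; rewrite /T bE xab.
    have iaN : val i <> val a by move=> /val_inj je; rewrite je eqxx in ia.
    have ibN : val i <> (val a).+1.
      by rewrite -bE => /val_inj je; rewrite je eqxx in ib.
    case: ifP => ai; last first.
      by rewrite ifF ?addr0 //; move: ai iaN ibN => /=; lia.
    have ai1 : (i < (val a).+1)%N by move: ai => /=; lia.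
    rewrite ai1 addnS exprS mulN1r scaleNr; apply/eqP; rewrite subr_eq0; apply/eqP.
    congr (_ *: f (fcons _ _)); apply/funext => k.
    move: (lift (inord i) k : 'I_n.+1) => l.
    case: (eqVneq (val l) (val a)) => la; last first.
      congr x; apply: val_inj; rewrite /= /bump bE.
      by rewrite leq_eqVlt [val a == val l]eq_sym (negbTE la).
    transitivity (x b); [|rewrite -xab]; congr (x _); apply: val_inj;
      rewrite [LHS]/= [RHS]/= /bump ?bE; move: la => /=; lia.
  apply: (sum_pair0 abN) => [|i ia ib].
    rewrite -big_split /=; apply: big1 => j _.
    case: (eqVneq j a) => [->|ja]; first by rewrite Taa Tba addr0.
    case: (eqVneq j b) => [->|jb]; first by rewrite Taa Tab addr0.
    exact: Tl.
  by apply: (sum_pair0 abN) => [|j ja jb]; [exact: Tr|exact: T1].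
- rewrite bE exprS mulN1r scaleNr xab; apply/eqP; rewrite subr_eq0; apply/eqP.
  congr (_ *: rho _ (f _)); apply/funext => k.
  case: (eqVneq (val k) (val a)) => ka; last first.
    by congr x; apply: val_inj; rewrite /= /bump bE; move: ka => /=; lia.
  transitivity (x b); [|rewrite -xab]; congr (x _); apply: val_inj;
    rewrite /= /bump ?bE; move: ka => /=; lia.
- move=> i ia ib.
  case: (unliftP i a) ia => [s sE _|->]; last by rewrite eqxx.
  case: (unliftP i b) ib => [t tE _|->]; last by rewrite eqxx.
  rewrite (fa _ s t) -?sE -?tE //; last by apply: contra_neq abN => st; rewrite sE st -tE.
  by rewrite linear_map0 ?scaler0.
Qed.

Lemma ce_linear n (x : 'I_n.+2 -> V) :
  linear (fun f : ('I_n.+1 -> V) -> V => ce_formula rho B f x).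
Proof.
apply: linear_add; apply: linear_sum => i _.
  by apply: linear_scale => a u v; rewrite -rhor.
by apply: linear_sum => j _; apply: linear_scale => a u v.
Qed.

End CE.

Section PartialN.
Variable N : V -> V.
Hypothesis Nlin : linear N.

Lemma iter_linear k : linear (iter k N).
Proof. by elim: k => [|k IH] a u v //=; rewrite IH Nlin. Qed.

Lemma partialN_multilinear n (f : ('I_n -> V) -> V) :
  multilinear f -> multilinear (partialN_fun N f).
Proof.
move=> fm s x; apply: linear_sum => k _; apply: linear_scale.
apply: linear_comp; first exact: iter_linear.
apply: linear_sum => I _.
have -> : (fun v => f (fun i => if i \in I then [eta x with s |-> v] i
                                else N ([eta x with s |-> v] i))) =
  (fun v => f [eta (fun i => if i \in I then x i else N (x i)) with
                s |-> if s \in I then v else N v]).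
  by apply/funext => v; congr (f _); apply/funext => i /=; case: eqP => [->|].
apply: (@linear_comp _ _ _ (fun w => f [eta _ with s |-> w])
  (fun v => if s \in I then v else N v) (fm _ _)).
by case: (s \in I).
Qed.

Lemma partialN_alternating n (f : ('I_n -> V) -> V) :
  multilinear f -> alternating f -> alternating (partialN_fun N f).
Proof.
move=> fm fa x a b ab xab; rewrite /partialN_fun big1 // => k _.
suff -> : \sum_(I : {set 'I_n} | #|I| == k)
    f (fun i => if i \in I then x i else N (x i)) = 0.
  by rewrite (linear_map0 (@iter_linear k)) scaler0.
pose F (I : {set 'I_n}) := f (fun i => if i \in I then x i else N (x i)).
change (\sum_(I : {set 'I_n} | #|I| == k) F I = 0).
have xt i : x (tperm a b i) = x i by case: tpermP => // ->.
have F0 (I : {set 'I_n}) : (a \in I) = (b \in I) -> F I = 0.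
  by move=> abI; apply: (fa _ a b ab); rewrite abI xab.
pose tI (I : {set 'I_n}) := [set i | tperm a b i \in I].
have FS (I : {set 'I_n}) : F (tI I) = - F I.
  rewrite -(multilinear_swap fm ab) => [|y]; last exact: fa.
  by congr (f _); apply/funext => i; rewrite inE xt.
have tIK : involutive tI by move=> I; apply/setP => i; rewrite !inE tpermK.
have tIc (I : {set 'I_n}) : #|tI I| = #|I|.
  have -> : tI I = tperm a b @^-1: I by apply/setP => i; rewrite !inE.
  rewrite on_card_preimset //; apply: onW_bij.
  by exists (tperm a b) => i; rewrite tpermK.
rewrite (bigID (fun I : {set 'I_n} => (a \in I) == (b \in I))) /= big1 ?add0r; last first.
  by move=> I /andP[_ /eqP /F0].
rewrite (bigID (fun I : {set 'I_n} => a \in I)) /=.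
apply/eqP; rewrite addrC addr_eq0; apply/eqP.
rewrite (reindex_inj (inv_inj tIK)) /= -sumrN.
apply: eq_big => [I|I _]; last exact: FS.
rewrite tIc !inE tpermL tpermR.
by case: (a \in I); case: (b \in I); rewrite ?andbF ?andbT.
Qed.

Lemma partialN_linear n (x : 'I_n -> V) :
  linear (fun f : ('I_n -> V) -> V => partialN_fun N f x).
Proof.
apply: linear_sum => k _; apply: linear_scale; apply: linear_comp.
  exact: iter_linear.
by apply: linear_sum => I _ a u v.
Qed.

End PartialN.

End Closure.

Section NijenhuisComplex.
Variables (K : fieldType) (g : lieAlgType K) (N : {linear g -> g}).

Lemma N_lin : linear N.
Proof. exact: linearP. Qed.

Lemma lie_deformed_linearl y : linear (fun x => lie_deformed N x y).
Proof.
apply: linear_add; first apply: linear_add.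
- exact: (linear_comp (lie_linearl y) N_lin).
- exact: lie_linearl.
move=> a u v; rewrite lie_linearl linearP.
by rewrite opprD scalerN.
Qed.

Lemma lie_deformed_linearr x : linear (lie_deformed N x).
Proof.
apply: linear_add; first apply: linear_add.
- exact: lie_linearr.
- exact: (linear_comp (lie_linearr x) N_lin).
move=> a u v; rewrite lie_linearr linearP.
by rewrite opprD scalerN.
Qed.

Lemma lie_anti (x y : g) : lie x y = - lie y x.
Proof.
have := liexx (x + y).
have addl (u v w : g) : lie (u + v) w = lie u w + lie v w.
  by have := lie_linearl w 1 u v; rewrite !scale1r.
have addr (u v w : g) : lie w (u + v) = lie w u + lie w v.
  by have := lie_linearr w 1 u v; rewrite !scale1r.
by rewrite addl !addr !liexx add0r addr0 => /eqP; rewrite addr_eq0 => /eqP.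
Qed.

Lemma lie_deformedxx x : lie_deformed N x x = 0.
Proof. by rewrite /lie_deformed lie_anti addNr liexx linear0 subr0. Qed.

Lemma ce_fun_alt n (f : altHom g n.+1) : ce_fun f \in alt_pred g n.+2.
Proof.
have [fm fa] := alt_predP _ (alt_funP f).
apply/alt_predP; split.
  by apply: ce_multilinear => // x; [exact: lie_linearl|exact: lie_linearr
    |exact: lie_linearl|exact: lie_linearr].
by apply: ce_alternating => // x; [exact: lie_linearl|exact: lie_linearr
  |exact: lie_linearl|exact: lie_linearr|exact: liexx].
Qed.

Lemma dN_fun_alt n (f : altHom g n.+1) : dN_fun N f \in alt_pred g n.+2.
Proof.
have [fm fa] := alt_predP _ (alt_funP f).
have [cm ca] := alt_predP _ (ce_fun_alt f).
have rl y : linear (fun u => lie (N u) y) by exact: (linear_comp (lie_linearl y) N_lin).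
have rr u : linear (lie (N u)) by exact: lie_linearr.
apply/alt_predP; split=> [i x a u v|x i j ij xij]; rewrite /dN_fun.
  rewrite cm (ce_multilinear rl rr lie_deformed_linearl lie_deformed_linearr fm).
  by rewrite linearP opprD scalerBr addrACA.
rewrite (ca _ _ _ ij xij) linear0 subr0.
exact: (ce_alternating rl rr lie_deformed_linearl lie_deformed_linearr
  lie_deformedxx fm fa ij xij).
Qed.

Lemma partialN_fun_alt n (f : altHom g n) : partialN_fun N f \in alt_pred g n.
Proof.
have [fm fa] := alt_predP _ (alt_funP f).
apply/alt_predP; split; first exact: (partialN_multilinear N_lin).
exact: (partialN_alternating N_lin).
Qed.

Definition delta_CE n (f : altHom g n.+1) : altHom g n.+2 := AltHom (ce_fun_alt f).

Definition d_N n (f : altHom g n.+1) : altHom g n.+2 := AltHom (dN_fun_alt f).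

Definition partial_N n (f : altHom g n) : altHom g n := AltHom (partialN_fun_alt f).

Lemma delta_CE_linear n : linear (@delta_CE n).
Proof.
move=> a u v; apply/val_inj/funext => x /=.
exact: (ce_linear lie lie_linearr).
Qed.
HB.instance Definition _ n :=
  GRing.isLinear.Build K (altHom g n.+1) (altHom g n.+2) _ (@delta_CE n)
    (@delta_CE_linear n).

Lemma d_N_linear n : linear (@d_N n).
Proof.
move=> a u v; apply/val_inj/funext => x /=; rewrite /dN_fun /ce_fun.
rewrite (ce_linear lie lie_linearr).
have rr w : linear (lie (N w)) by exact: lie_linearr.
rewrite (ce_linear (lie_deformed N) rr).
by rewrite linearP opprD scalerBr addrACA.
Qed.
HB.instance Definition _ n :=
  GRing.isLinear.Build K (altHom g n.+1) (altHom g n.+2) _ (@d_N n)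
    (@d_N_linear n).

Lemma partial_N_linear n : linear (@partial_N n).
Proof.
move=> a u v; apply/val_inj/funext => x /=.
exact: (partialN_linear N_lin).
Qed.
HB.instance Definition _ n :=
  GRing.isLinear.Build K (altHom g n) (altHom g n) _ (@partial_N n)
    (@partial_N_linear n).

End NijenhuisComplex.

(* Hom(g, g) in degree 1 is altHom g 1, and the zero space in degree 0 is
   'rV[K]_0. *)
Definition NLie_cochain (K : fieldType) (g : lieAlgType K) (n : nat) : lmodType K :=
  match n with
  | 0 => 'rV[K]_0
  | 1 => altHom g 1
  | m.+2 => (altHom g m.+2 * altHom g m.+1)%type
  end.

Definition delta_NLie (K : fieldType) (g : lieAlgType K) (N : {linear g -> g})
    (n : nat) : NLie_cochain g n -> NLie_cochain g n.+1 :=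
  match n return NLie_cochain g n -> NLie_cochain g n.+1 with
  | 0 => fun _ => 0
  | 1 => fun f => (delta_CE f, - partial_N N f)
  | m.+2 => fun c =>
      (delta_CE c.1, d_N N c.2 + (-1) ^+ m.+2 *: partial_N N c.1)
  end.

Lemma delta_NLie_linear (K : fieldType) (g : lieAlgType K) (N : {linear g -> g}) n :
  linear (@delta_NLie K g N n).
Proof.
case: n => [|[|n]] a u v.
- by rewrite /= scaler0 addr0.
- congr (_, _); rewrite linearP //=.
  by rewrite opprD scalerN.
- congr (_, _); first exact: linearP.
  have pE : partial_N N (a *: u + v).1 = a *: partial_N N u.1 + partial_N N v.1.
    exact: (linearP (@partial_N K g N n.+2)).
  have dE : d_N N (a *: u + v).2 = a *: d_N N u.2 + d_N N v.2.
    exact: (linearP (@d_N K g N n)).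
  by rewrite /= dE pE !scalerDr !scalerA mulrC addrACA.
Qed.
HB.instance Definition _ (K : fieldType) (g : lieAlgType K)
    (N : {linear g -> g}) n :=
  GRing.isLinear.Build K (NLie_cochain g n) (NLie_cochain g n.+1) _
    (@delta_NLie K g N n) (@delta_NLie_linear K g N n).

(* Main.v *)
Require Import Defs.
From HB Require Import structures.
From mathcomp Require Import all_boot all_order all_algebra.
From mathcomp Require Import perm all_classical.

Set Implicit Arguments.
Unset Strict Implicit.
Unset Printing Implicit Defensive.

Import GRing.Theory.
Local Open Scope ring_scope.

(** Write d for the Chevalley-Eilenberg differential of the Lie bracket, B_N
for the deformed bracket, d' for the Chevalley-Eilenberg differential of B_N
with g as a module through ad o N, and P for the operator partial^N.  Then
d_N f = d' f - N (d f), and expanding the square of the differential leaves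
three identities: d d = 0, d_N d_N = 0 and d_N P = P d.  Throughout, signs are
handled without dividing, so the argument is uniform in the characteristic.

Vanishing of squares.  For any bilinear bracket B with the Leibniz identity
and any representation rho of it, the recursion i_a D = L_a - D i_a (Cartan's
formula, i_a being the insertion of a as first argument and L_a the Lie
derivative) defines an operator D on all cochains, alternating or not.
For multilinear maps, comparing insertions and inducting on the degree gives
L_[a,b] = [L_a, L_b], then [L_a, D] = 0, then D D = 0 (cartan_dK), with no
double sum.  On alternating maps D is the classical formula (cartan_d_ce).

d_N d_N = 0.  The Nijenhuis identity says that N is a morphism from B_N to
the bracket; hence B_N is again a Lie bracket, ad o N represents it, and
d' d' = 0.  The map id + N is Nijenhuis too, and its deformed data are the
sums of the original and the N-deformed ones, so (d + d')^2 = 0; therefore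
d d' + d' d = 0 (ce_deformed_anticomm).  Finally the commutators with
composition by N satisfy [d', N] = N [d, N] (ce_deformed_comp), since the
bracket terms of the two formulas commute with N and the others are compared by
the Nijenhuis identity.  These relations give
d_N d_N = - N (d d' + d' d) = 0 (dN_funK).

d_N P = P d.  Let T_i be precomposition with N in slot i minus composition
with N.  The T_i commute, and the sum over subsets defining P is the
expanded product of all of them; partialN_insert is the extraction of one
factor.  The identity then holds separately for every term of the
Chevalley-Eilenberg sums: T_i turns [x_i, f] into
[N x_i, f] - N [x_i, f], an operation on f commuting with N
(partialN_action), and T_i T_j turns f([x_i, x_j], ...) into the first-slot
factor of P at B_N(x_i, x_j) minus N times the same factor at [x_i, x_j]
(partialN_bracket).  *)

(** Proves equalities between sums in an abelian group by moving all terms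
to the left and cancelling opposite pairs. *)
Ltac zmod :=
  apply/eqP; rewrite -subr_eq0; apply/eqP;
  rewrite ?(opprD, opprK, oppr0, addr0, add0r);
  rewrite -[LHS]addr0 -?addrA;
  repeat match goal with
  | |- @eq _ (?x + _)%R _ =>
    lazymatch x with
    | (- ?a)%R => rewrite ![_ + (a + _)]addrCA addNKr
    | _ => rewrite ![_ + (- x + _)]addrCA addKr
    end
  end; try reflexivity.

(** * The Cartan recursion for the Chevalley-Eilenberg differential *)

Section Cartan.
Variables (K : fieldType) (V : lmodType K).

Definition tail n (x : 'I_n.+1 -> V) : 'I_n -> V := fun k => x (lift ord0 k).

Definition contract n (a : V) (f : ('I_n.+1 -> V) -> V) : ('I_n -> V) -> V :=
  fun y => f (fcons a y).

Lemma family0 (x y : 'I_0 -> V) : x = y.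
Proof. by apply/funext => -[]. Qed.

Lemma fcons_ext n (x y : 'I_n.+1 -> V) :
  x ord0 = y ord0 -> tail x = tail y -> x = y.
Proof.
move=> xy0 /funeqP xyS; apply/funext => k.
by case: (unliftP ord0 k) => [k' ->|->//]; exact: xyS.
Qed.

Lemma tail_fcons n (a : V) (y : 'I_n -> V) : tail (fcons a y) = y.
Proof. by apply/funext => k; rewrite /tail fconsS. Qed.

Lemma fcons_eta n (x : 'I_n.+1 -> V) : fcons (x ord0) (tail x) = x.
Proof. by apply: fcons_ext; rewrite ?fcons0 ?tail_fcons. Qed.

Lemma fcons_comp_lift n (a : V) (y : 'I_n.+1 -> V) (j : 'I_n.+1) :
  (fun k => fcons a y (lift (lift ord0 j) k)) = fcons a (fun k => y (lift j k)).
Proof.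
have l0 : lift (lift ord0 j) ord0 = ord0 by apply: val_inj.
have lS k : lift (lift ord0 j) (lift ord0 k) = lift ord0 (lift j k).
  by apply: val_inj; rewrite /= /bump /= !add1n ltnS addnS.
apply: fcons_ext; first by rewrite l0 !fcons0.
by apply/funext => k; rewrite /tail lS !fconsS.
Qed.

Lemma multilinearD n (f : ('I_n -> V) -> V) i x u v : multilinear f ->
  f [eta x with i |-> u + v] = f [eta x with i |-> u] + f [eta x with i |-> v].
Proof. by move=> /(_ i x 1 u v); rewrite !scale1r. Qed.

Lemma contract_multilinear n a (f : ('I_n.+1 -> V) -> V) :
  multilinear f -> multilinear (contract a f).
Proof.
move=> fm i x b u v; rewrite /contract !fcons_upd; exact: fm.
Qed.

Lemma contract_alternating n a (f : ('I_n.+1 -> V) -> V) :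
  alternating f -> alternating (contract a f).
Proof.
move=> fa x i j ij xij; apply: (fa _ (lift ord0 i) (lift ord0 j)).
  by rewrite (inj_eq lift_inj).
by rewrite !fconsS.
Qed.

Lemma contractD n a b (f : ('I_n.+1 -> V) -> V) : multilinear f ->
  contract (a + b) f = contract a f + contract b f.
Proof.
move=> fm; apply/funext => y; rewrite fctE /contract.
by rewrite fcons_upd0 multilinearD // -!fcons_upd0.
Qed.

Lemma contractB n a (f h : ('I_n.+1 -> V) -> V) :
  contract a (f - h) = contract a f - contract a h.
Proof. by []. Qed.

(** The induction principle for all identities between operators below:
cochains of positive degree are compared through their insertions. *)
Lemma contract_inj n (f h : ('I_n.+1 -> V) -> V) :
  (forall a, contract a f = contract a h) -> f = h.
Proof.
move=> fh; apply/funext => x; rewrite -(fcons_eta x).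
exact: (congr1 (@^~ (tail x)) (fh (x ord0))).
Qed.

Lemma funB (T : Type) (f h : T -> V) y : (f - h) y = f y - h y.
Proof. by []. Qed.

Lemma alternating_swap_front n a b (f : ('I_n.+2 -> V) -> V) z :
  multilinear f -> alternating f ->
  f (fcons a (fcons b z)) = - f (fcons b (fcons a z)).
Proof.
move=> fm fa.
pose i1 : 'I_n.+2 := lift ord0 ord0.
have i01 : ord0 != i1 by [].
rewrite -(multilinear_swap fm i01) => [|x]; last exact: fa.
congr (f _); apply: fcons_ext; first by rewrite tpermL fconsS !fcons0.
apply: fcons_ext; first by rewrite /tail tpermR fconsS !fcons0.
apply/funext => k; rewrite /tail tpermD ?fconsS //.
Qed.

(** Moving the first argument to position j crosses j arguments; this trades
the position-0 brackets of the Chevalley-Eilenberg formula for the in-place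
brackets of the Lie derivative. *)
Lemma alternating_front n b (f : ('I_n.+1 -> V) -> V) y (j : 'I_n.+1) :
  multilinear f -> alternating f ->
  f (fcons b (fun k => y (lift j k))) = (-1) ^+ j *: f [eta y with j |-> b].
Proof.
elim: n f y j => [|n IH] f y j fm fa; case: (unliftP ord0 j) => [j' ->|->].
- by case: j'.
- rewrite expr0 scale1r; congr (f _).
  by apply: fcons_ext; rewrite ?fcons0 //; exact: family0.
- rewrite -{1 2}(fcons_eta y) fcons_comp_lift alternating_swap_front //.
  have := IH (contract (y ord0) f) (tail y) j'.
  rewrite /contract lift0 exprS mulN1r scaleNr => ->.
  + by rewrite fcons_upd; congr (- (_ *: f _));
      apply/funext => k /=; rewrite fcons_eta.
  + exact: contract_multilinear.
  + exact: contract_alternating.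
- rewrite expr0 scale1r; congr (f _).
  apply: fcons_ext; rewrite ?fcons0 //.
  by apply/funext => k; rewrite /tail fconsS.
Qed.

Section Operators.
Variables rho B : V -> V -> V.

(** The body is locked because unification would otherwise see a value of
lie_der as a difference, and the group laws would rewrite inside it. *)
Definition lie_der n (a : V) (f : ('I_n -> V) -> V) (y : 'I_n -> V) : V :=
  locked (rho a (f y) - \sum_(j < n) f [eta y with j |-> B a (y j)]).

(** Cartan's formula i_a D = L_a - D i_a taken as a definition.  It makes sense
in degree 0 and for maps that do not alternate.  Locked for the same reason as
lie_der. *)
Fixpoint cartan_d n : (('I_n -> V) -> V) -> ('I_n.+1 -> V) -> V :=
  match n with
  | 0 => fun f x => rho (x ord0) (f (tail x))
  | _.+1 => fun f x =>
      locked (lie_der (x ord0) f (tail x)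
              - cartan_d (contract (x ord0) f) (tail x))
  end.

Lemma lie_derE n a (f : ('I_n -> V) -> V) y :
  lie_der a f y = rho a (f y) - \sum_(j < n) f [eta y with j |-> B a (y j)].
Proof. by rewrite /lie_der -lock. Qed.

Lemma lie_der0 a (f : ('I_0 -> V) -> V) y : lie_der a f y = rho a (f y).
Proof. by rewrite lie_derE big_ord0 subr0. Qed.

Lemma lie_derS n a (f : ('I_n.+1 -> V) -> V) y :
  lie_der a f y = lie_der a (contract (y ord0) f) (tail y)
                  - f (fcons (B a (y ord0)) (tail y)).
Proof.
rewrite !lie_derE {1}/contract fcons_eta -addrA -opprD big_ord_recl.
congr (_ - _); rewrite [RHS]addrC; congr (f _ + _).
  rewrite fcons_upd0; apply: fcons_ext; rewrite /= ?eqxx //.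
  by apply/funext => k; rewrite /tail /= fconsS.
apply: eq_bigr => i _; rewrite /contract fcons_upd; congr (f _).
by apply/funext => k /=; rewrite fcons_eta.
Qed.

Lemma cartan_d0 (f : ('I_0 -> V) -> V) x :
  cartan_d f x = rho (x ord0) (f (tail x)).
Proof. by []. Qed.

Lemma cartan_dS n (f : ('I_n.+1 -> V) -> V) x :
  cartan_d f x =
  lie_der (x ord0) f (tail x) - cartan_d (contract (x ord0) f) (tail x).
Proof. by rewrite /= -lock. Qed.

(** The indices i = 0 of the two sums, namely rho a (f y) and the brackets of
a with each y_j, assemble into the Lie derivative along a. *)
Lemma ce_formula_fcons n a (f : ('I_n.+1 -> V) -> V) (y : 'I_n.+1 -> V) :
  multilinear f -> alternating f ->
  ce_formula rho B f (fcons a y) = lie_der a f y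
   - (\sum_(i < n.+1) (-1) ^+ i *:
        rho (y i) (f (fun k => fcons a y (lift (lift ord0 i) k)))
      - \sum_(i < n.+1) \sum_(j < n.+1 | (i < j)%N) (-1) ^+ (i + j) *:
        f (fcons (B (y i) (y j))
          (fun k => fcons a y (lift (lift ord0 j) (lift (inord i.+1) k))))).
Proof.
move=> fm fa; rewrite /ce_formula lie_derE big_ord_recl.
rewrite [X in _ + X]big_ord_recl [X in _ + (X + _)]big_mkcond.
rewrite [X in _ + (X + _)]big_ord_recl ltnn [X in _ + (X + _)]add0r.
have -> : (fun k => fcons a y (lift ord0 k)) = y.
  by apply/funext => k; rewrite fconsS.
rewrite expr0 scale1r fcons0.
rewrite opprD opprK [RHS]addrACA; congr ((_ + _) + (_ + _)).
- rewrite -sumrN; apply: eq_bigr => i _.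
  by rewrite fconsS lift0 exprS mulN1r scaleNr.
- rewrite -sumrN; apply: eq_bigr => i _.
  have -> : (fun k => fcons a y (lift (lift ord0 i) (lift (inord 0) k)))
            = (fun k => y (lift i k)).
    apply/funext => k; rewrite -(fconsS a y); congr (fcons a y _).
    by apply: val_inj; rewrite /= /bump inordK //= !add1n addnS ltnS.
  rewrite fconsS alternating_front // add0n lift0 exprS mulN1r !scaleNr.
  by rewrite scalerA -exprMn mulN1r opprK expr1n scale1r.
- apply: eq_bigr => i _; rewrite big_mkcond big_ord_recl ltn0 [LHS]add0r.
  rewrite [RHS]big_mkcond; apply: eq_bigr => j _.
  by rewrite !lift0 ltnS addSn addnS !exprS !mulN1r opprK !fconsS.
Qed.

(** What remains after splitting off the Lie derivative is the formula for the
insertion of the first argument, up to sign: in the bracket terms that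
argument stands in second position, and f alternates. *)
Lemma cartan_d_ce n (f : ('I_n.+1 -> V) -> V) :
  multilinear f -> alternating f -> cartan_d f = ce_formula rho B f.
Proof.
elim: n f => [|n IH] f fm fa; apply/funext => x;
  rewrite -{2}(fcons_eta x) ce_formula_fcons // cartan_dS; congr (_ - _).
  rewrite !big_ord1 big_pred0 => [|j]; last by rewrite (ord1 j).
  rewrite cartan_d0 expr0 scale1r subr0 /contract fcons_comp_lift.
  by congr (rho _ (f (fcons _ _))); exact: family0.
rewrite IH; first last.
- exact: contract_alternating.
- exact: contract_multilinear.
rewrite /ce_formula; congr (_ + _).
  apply: eq_bigr => i _; congr (_ *: rho _ _).
  by rewrite fcons_comp_lift.
rewrite -sumrN; apply: eq_bigr => i _; rewrite -sumrN; apply: eq_bigr => j ij.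
rewrite -scalerN; congr (_ *: _); rewrite /contract alternating_swap_front //.
congr (- f (fcons _ _)).
have -> : inord i.+1 = lift ord0 (inord i : 'I_n.+1).
  have lin : (i < n.+1)%N by rewrite (leq_trans ij) // -ltnS.
  by apply: val_inj; rewrite /= /bump !inordK.
rewrite -(fcons_comp_lift (x ord0) (fun k => tail x (lift j k))).
by apply/funext => k; rewrite -fcons_comp_lift.
Qed.

Hypothesis rhor : forall x, linear (rho x).

Lemma rhoB x u v : rho x (u - v) = rho x u - rho x v.
Proof. by rewrite addrC -scaleN1r rhor scaleN1r addrC. Qed.

Lemma lie_derB n a (f h : ('I_n -> V) -> V) :
  lie_der a (f - h) = lie_der a f - lie_der a h.
Proof.
apply/funext => y; rewrite !lie_derE !fctE !lie_derE rhoB.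
rewrite big_split sumrN /=; zmod.
Qed.

Lemma cartan_dB n (f h : ('I_n -> V) -> V) :
  cartan_d (f - h) = cartan_d f - cartan_d h.
Proof.
elim: n f h => [|n IH] f h; apply/funext => x; rewrite !fctE.
  by rewrite !cartan_d0 rhoB.
rewrite !cartan_dS contractB IH lie_derB !fctE; zmod.
Qed.

Lemma contract_lie_der n a b (f : ('I_n.+1 -> V) -> V) :
  contract b (lie_der a f) = lie_der a (contract b f) - contract (B a b) f.
Proof.
by apply/funext => y; rewrite fctE {1}/contract lie_derS fcons0 tail_fcons.
Qed.

Lemma contract_cartan_d n a (f : ('I_n.+1 -> V) -> V) :
  contract a (cartan_d f) = lie_der a f - cartan_d (contract a f).
Proof.
by apply/funext => y; rewrite fctE {1}/contract cartan_dS fcons0 tail_fcons.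
Qed.

Hypothesis rep : forall x y v,
  rho (B x y) v = rho x (rho y v) - rho y (rho x v).
Hypothesis leibniz : forall x y z, B x (B y z) = B (B x y) z + B y (B x z).

(** Inserting z turns the commutator of L_a and L_b into the same commutator
in lower degree, up to the insertion of the two sides of the Leibniz identity
for a, b and z. *)
Lemma lie_der_bracket n a b (f : ('I_n -> V) -> V) : multilinear f ->
  lie_der (B a b) f = lie_der a (lie_der b f) - lie_der b (lie_der a f).
Proof.
elim: n f => [|n IH] f fm.
  by apply/funext => y; rewrite funB !lie_der0 rep.
apply: contract_inj => z; rewrite contractB !contract_lie_der !lie_derB.
rewrite (leibniz a b z) contractD // IH; last exact: contract_multilinear.
zmod.
Qed.

(** Inserting b reduces [L_a, D] to the negative of [L_a, D] on the insertion
of b, because L_[a,b] = [L_a, L_b] cancels the other terms. *)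
Lemma lie_der_cartan_d n a (f : ('I_n -> V) -> V) : multilinear f ->
  lie_der a (cartan_d f) = cartan_d (lie_der a f).
Proof.
elim: n f => [|n IH] f fm; apply: contract_inj => b.
  apply/funext => y; rewrite contract_lie_der !fctE lie_der0 /contract.
  rewrite !cartan_d0 ?lie_der0 !fcons0 !tail_fcons rep; zmod.
rewrite contract_lie_der !contract_cartan_d !contract_lie_der !lie_derB.
rewrite cartan_dB lie_der_bracket // IH; last exact: contract_multilinear.
zmod.
Qed.

(** Inserting a in D D f gives L_a D f - D L_a f + D D (i_a f); the first two
terms cancel and the last vanishes by induction. *)
Lemma cartan_dK n (f : ('I_n -> V) -> V) : multilinear f ->
  cartan_d (cartan_d f) = 0.
Proof.
elim: n f => [|n IH] f fm; apply: contract_inj => a; rewrite contract_cartan_d.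
  have -> : contract a (cartan_d f) = lie_der a f.
    apply/funext => y.
    by rewrite /contract cartan_d0 lie_der0 fcons0 tail_fcons.
  by rewrite lie_der_cartan_d // subrr.
rewrite contract_cartan_d cartan_dB lie_der_cartan_d // IH.
  by rewrite subr0 subrr.
exact: contract_multilinear.
Qed.

Lemma ce_formulaK n (f : ('I_n.+1 -> V) -> V) :
  (forall y, linear (rho^~ y)) -> (forall y, linear (B^~ y)) ->
  (forall x, linear (B x)) -> (forall x, B x x = 0) ->
  multilinear f -> alternating f ->
  ce_formula rho B (ce_formula rho B f) = 0.
Proof.
move=> rhol Bl Br Bxx fm fa.
rewrite -cartan_d_ce; first by rewrite -cartan_d_ce // cartan_dK.
- exact: ce_multilinear.
- exact: ce_alternating.
Qed.

End Operators.
End Cartan.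

(** * Dependence of the differential on its data *)

Section CeFormula.
Variables (K : fieldType) (V : lmodType K).
Implicit Types rho B : V -> V -> V.

Lemma ce_formulaB rho B n (f h : ('I_n.+1 -> V) -> V) :
  (forall x, linear (rho x)) ->
  ce_formula rho B (f - h) = ce_formula rho B f - ce_formula rho B h.
Proof.
move=> rhor; apply/funext => x; rewrite funB.
have := ce_linear B rhor x (-1) h f.
by rewrite !scaleN1r (addrC (- h)) => ->; rewrite addrC.
Qed.

Lemma ce_formula_add rho rho' B B' n (f : ('I_n.+1 -> V) -> V) :
  multilinear f ->
  ce_formula (fun u v => rho u v + rho' u v) (fun u v => B u v + B' u v) f
  = ce_formula rho B f + ce_formula rho' B' f.
Proof.
move=> fm; apply/funext => x; rewrite fctE /ce_formula [RHS]addrACA.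
congr (_ + _); rewrite -big_split /=.
  by apply: eq_bigr => i _; rewrite scalerDr.
apply: eq_bigr => i _; rewrite -big_split; apply: eq_bigr => j _ /=.
by rewrite -scalerDr fcons_upd0 multilinearD // -!fcons_upd0.
Qed.

(** Only the action terms fail to commute with a linear map of the values. *)
Lemma ce_formula_comp rho B (p : {linear V -> V}) n
    (f : ('I_n.+1 -> V) -> V) x :
  ce_formula rho B (p \o f) x - p (ce_formula rho B f x) =
  \sum_(i < n.+2) (-1) ^+ i *: (rho (x i) (p (f (fun k => x (lift i k))))
                               - p (rho (x i) (f (fun k => x (lift i k))))).
Proof.
rewrite /ce_formula linearD /= opprD addrACA !(GRing.linear_sum p) -!sumrB.
rewrite [X in _ + X]big1 => [|i _]; last first.
  rewrite (GRing.linear_sum p) -sumrB big1 // => j _.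
  by rewrite linearZ_LR subrr.
by rewrite addr0; apply: eq_bigr => i _; rewrite linearZ_LR scalerBr.
Qed.

End CeFormula.

(** * The deformed bracket of a Nijenhuis operator *)

Section LieAlgebra.
Variables (K : fieldType) (g : lieAlgType K).

HB.instance Definition _ (x : g) :=
  GRing.isLinear.Build K g g _ (lie x) (lie_linearr x).

Lemma lieDr (x y z : g) : lie x (y + z) = lie x y + lie x z.
Proof. exact: linearD. Qed.

Lemma lieNr (x y : g) : lie x (- y) = - lie x y.
Proof. exact: linearN. Qed.

Lemma lieDl (x y z : g) : lie (x + y) z = lie x z + lie y z.
Proof. by have := lie_linearl z 1 x y; rewrite !scale1r. Qed.

Lemma lieNl (x z : g) : lie (- x) z = - lie x z.
Proof. by rewrite lie_anti lieNr opprK [in RHS]lie_anti opprK. Qed.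

Lemma lie_leibniz (x y z : g) :
  lie x (lie y z) = lie (lie x y) z + lie y (lie x z).
Proof.
have := lie_jacobi x y z.
rewrite (lie_anti z x) (lie_anti z (lie x y)) linearN => /eqP.
by rewrite -addrA -opprD subr_eq0 => /eqP ->; rewrite addrC.
Qed.

Lemma lie_lie (x y z : g) :
  lie (lie x y) z = lie x (lie y z) - lie y (lie x z).
Proof. by rewrite lie_leibniz addrK. Qed.

Section Nijenhuis.
Variable N : {linear g -> g}.
Hypothesis hN : nijenhuis N.

Lemma lie_deformed_rep (x y v : g) :
  lie (N (lie_deformed N x y)) v
  = lie (N x) (lie (N y) v) - lie (N y) (lie (N x) v).
Proof. by rewrite -hN lie_lie. Qed.

(** Expand both sides, using the Nijenhuis identity on N of a deformed bracket
and again on the brackets [N x, N [y, z]]; Leibniz for the original bracket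
then brings every term to a bracket of the shape [x, [y, z]] or [y, [x, z]]. *)
Lemma lie_deformed_leibniz (x y z : g) :
  lie_deformed N x (lie_deformed N y z)
  = lie_deformed N (lie_deformed N x y) z
    + lie_deformed N y (lie_deformed N x z).
Proof.
rewrite {1 3 5}/lie_deformed -!hN /lie_deformed.
rewrite !(linearD N, linearN N, lieDr, lieNr, lieDl, lieNl) /=.
rewrite (hN x (lie y z)) (hN y (lie x z)) (hN (lie x y) z) /lie_deformed.
rewrite !(linearD N, linearN N, lieDr, lieNr) /= !lie_lie.
rewrite !(linearD N, linearN N, lieDr, lieNr) /=.
zmod.
Qed.

Lemma nijenhuis_id_add : nijenhuis (idfun \+ N).
Proof.
move=> x y; rewrite /lie_deformed /=.
rewrite !(linearD N, linearN N, lieDr, lieNr, lieDl) /= hN /lie_deformed.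
rewrite !(linearD N, linearN N, lieDr, lieNr) /=.
zmod.
Qed.

Lemma lie_deformed_id_add (x y : g) :
  lie_deformed (idfun \+ N) x y = lie x y + lie_deformed N x y.
Proof. by rewrite /lie_deformed /= lieDl lieDr; zmod. Qed.

End Nijenhuis.

(** * The square of d_N *)

Local Notation ce := (ce_formula (@lie K g) lie).

Lemma ce_lieK n (f : ('I_n.+1 -> g) -> g) : multilinear f -> alternating f ->
  ce (ce f) = 0.
Proof.
apply: ce_formulaK.
- exact: lie_linearr.
- exact: lie_lie.
- exact: lie_leibniz.
- exact: lie_linearl.
- exact: lie_linearl.
- exact: lie_linearr.
- exact: liexx.
Qed.

Lemma ce_deformedK (N : {linear g -> g}) n (f : ('I_n.+1 -> g) -> g) :
  nijenhuis N -> multilinear f -> alternating f ->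
  ce_formula (fun u v => lie (N u) v) (lie_deformed N)
    (ce_formula (fun u v => lie (N u) v) (lie_deformed N) f) = 0.
Proof.
move=> hN; apply: ce_formulaK.
- by move=> x; exact: lie_linearr.
- exact: lie_deformed_rep.
- exact: lie_deformed_leibniz.
- by move=> y; exact: (linear_comp (lie_linearl y) (N_lin N)).
- exact: lie_deformed_linearl.
- exact: lie_deformed_linearr.
- exact: lie_deformedxx.
Qed.

Section Differential.
Variable N : {linear g -> g}.
Hypothesis hN : nijenhuis N.

Local Notation ceN :=
  (ce_formula (fun u v => lie (N u) v) (lie_deformed N)).

(** The deformed data of id + N are the sums of the original and the deformed
data, so this is the cross term of the vanishing square (d + d')^2. *)
Lemma ce_deformed_anticomm n (f : ('I_n.+1 -> g) -> g) :
  multilinear f -> alternating f -> ceN (ce f) + ce (ceN f) = 0.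
Proof.
move=> fm fa.
pose M : {linear g -> g} := idfun \+ N.
pose ceM n := @ce_formula K g (fun u v => lie (M u) v) (lie_deformed M) n.
have ceME m (h : ('I_m.+1 -> g) -> g) : multilinear h -> ceM m h = ce h + ceN h.
  move=> hm; rewrite -ce_formula_add // /ceM; congr (ce_formula _ _ h).
    by do 2!apply/funext => ?; rewrite /M /= lieDl.
  by do 2!apply/funext => ?; exact: lie_deformed_id_add.
have : ceM n.+1 (ceM n f) = 0.
  by apply: ce_deformedK => //; exact: nijenhuis_id_add.
have cem : multilinear (ce f).
  by apply: ce_multilinear => // x; [exact: lie_linearl|exact: lie_linearr
    |exact: lie_linearl|exact: lie_linearr].
have ceNm : multilinear (ceN f).
  apply: ce_multilinear => //.
  - by move=> y; exact: (linear_comp (lie_linearl y) (N_lin N)).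
  - by move=> x; exact: lie_linearr.
  - exact: lie_deformed_linearl.
  - exact: lie_deformed_linearr.
have ceD rho B m (u v : ('I_m.+1 -> g) -> g) : (forall x, linear (rho x)) ->
    ce_formula rho B (u + v) = ce_formula rho B u + ce_formula rho B v.
  by move=> rhor; apply/funext => x; have := ce_linear B rhor x 1 u v;
    rewrite !scale1r.
rewrite (ceME n) // ceME; last first.
  by move=> i x; exact: (linear_add (cem i x) (ceNm i x)).
rewrite !(ceD _ _ _ (ce f)); [|by move=> x; exact: lie_linearr ..].
by rewrite ce_lieK // ce_deformedK // add0r addr0 addrC.
Qed.

(** Termwise this is the Nijenhuis identity
[N x, N v] - N [N x, v] = N ([x, N v] - N [x, v]). *)
Lemma ce_deformed_comp n (f : ('I_n.+1 -> g) -> g) :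
  ceN (N \o f) - (N \o ceN f) = N \o (ce (N \o f) - (N \o ce f)).
Proof.
apply/funext => x; rewrite !funB /= funB /= !ce_formula_comp linear_sum.
apply: eq_bigr => i _; rewrite linearZ_LR /=; congr (_ *: _).
rewrite hN /lie_deformed linearB linearD linearB /=; zmod.
Qed.

Lemma dN_funE n (f : ('I_n.+1 -> g) -> g) : dN_fun N f = ceN f - (N \o ce f).
Proof. by []. Qed.

Lemma dN_funK n (f : ('I_n.+1 -> g) -> g) : multilinear f -> alternating f ->
  dN_fun N (dN_fun N f) = 0.
Proof.
move=> fm fa.
have NB (T : Type) (u v : T -> g) : N \o (u - v) = (N \o u) - (N \o v).
  by apply/funext => x; rewrite /= !funB linearB.
have lier (x : g) : linear (lie x) by exact: lie_linearr.
rewrite !dN_funE (ce_formulaB (lie_deformed N)) //.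
rewrite (ce_formulaB lie) // ce_deformedK // sub0r NB.
have := ce_deformed_comp (ce f); rewrite ce_lieK //.
have -> : N \o (0 : ('I_n.+3 -> g) -> g) = 0.
  by apply/funext => x; rewrite /= linear0.
rewrite subr0 => /eqP; rewrite subr_eq => /eqP ->.
transitivity (- ((N \o ceN (ce f)) + (N \o ce (ceN f)))); first zmod.
apply/eqP; rewrite oppr_eq0; apply/eqP/funext => x; rewrite !fctE /= -linearD.
have /(congr1 (@^~ x)) := ce_deformed_anticomm fm fa.
by rewrite !fctE addrC => ->; rewrite linear0.
Qed.

End Differential.
End LieAlgebra.

(** * The operator partial^N one slot at a time *)

Section PartialN.
Variables (K : fieldType) (V : lmodType K) (N : {linear V -> V}).

Definition insert n (i : 'I_n.+1) (a : V) (y : 'I_n -> V) : 'I_n.+1 -> V :=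
  fun k => if unlift i k is Some k' then y k' else a.

Definition apply_off n (I : {set 'I_n}) (x : 'I_n -> V) : 'I_n -> V :=
  fun k => if k \in I then x k else N (x k).

Lemma insert_id n (i : 'I_n.+1) a (y : 'I_n -> V) : insert i a y i = a.
Proof. by rewrite /insert unlift_none. Qed.

Lemma insert_lift n (i : 'I_n.+1) a (y : 'I_n -> V) k :
  insert i a y (lift i k) = y k.
Proof. by rewrite /insert liftK. Qed.

Lemma insert_ord0 n a (y : 'I_n -> V) : insert ord0 a y = fcons a y.
Proof. by []. Qed.

Lemma iter_linearD k u v : iter k N (u + v) = iter k N u + iter k N v.
Proof.
by have := iter_linear (linearP N) k 1 u v; rewrite !scale1r.
Qed.

Lemma partialNE n (f : ('I_n -> V) -> V) x :
  partialN_fun N f x =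
  \sum_(I : {set 'I_n}) (-1) ^+ #|I| *: iter #|I| N (f (apply_off I x)).
Proof.
have szP (I : {set 'I_n}) : (#|I| < n.+1)%N.
  by rewrite ltnS -[leqRHS]card_ord max_card.
rewrite (partition_big (fun I => Ordinal (szP I)) xpredT) //=.
rewrite /partialN_fun big_mkord; apply: eq_bigr => k _.
rewrite (big_morph (iter k N) (iter_linearD k)
  (linear_map0 (iter_linear (linearP N) k))).
rewrite scaler_sumr; apply: eq_big => I; first by rewrite -val_eqE.
by move=> /eqP <-.
Qed.

(** Subsets of n+1 indices are sorted by whether they contain i; the image under
lift i encodes the trace on the other indices. *)
Lemma big_set_lift n (i : 'I_n.+1) (H : {set 'I_n.+1} -> V) :
  \sum_I H I = \sum_(J : {set 'I_n}) (H (lift i @: J) + H (i |: lift i @: J)).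
Proof.
have liftKset (I : {set 'I_n.+1}) : lift i @: (lift i @^-1: I) = I :\ i.
  apply/setP => k; rewrite !inE; case: (unliftP i k) => [k' ->|->].
    by rewrite (mem_imset _ _ (@lift_inj _ i)) inE eq_sym neq_lift.
  rewrite eqxx; apply/negbTE/imsetP => -[k' _ /eqP].
  by rewrite (negbTE (neq_lift _ _)).
have iNlift (J : {set 'I_n}) : i \notin lift i @: J.
  by apply/imsetP => -[k' _ /eqP]; rewrite (negbTE (neq_lift _ _)).
have preK (J : {set 'I_n}) : lift i @^-1: (lift i @: J) = J.
  by apply/setP => k; rewrite inE mem_imset //; exact: lift_inj.
rewrite big_split (bigID (fun I : {set 'I_n.+1} => i \in I)) /= addrC.
congr (_ + _).
  rewrite (reindex_onto (fun J : {set 'I_n} => lift i @: J)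
    (fun I : {set 'I_n.+1} => lift i @^-1: I)).
    by apply: eq_bigl => J; rewrite iNlift preK eqxx.
  move=> I iI; rewrite liftKset; apply/setP => k; rewrite !inE.
  by case: eqP => // ->; rewrite (negbTE iI).
rewrite (reindex_onto (fun J : {set 'I_n} => i |: lift i @: J)
    (fun I : {set 'I_n.+1} => lift i @^-1: I)).
  apply: eq_bigl => J; rewrite finset.setU11 /=; apply/eqP/setP => k.
  by rewrite !inE eq_sym (negbTE (neq_lift _ _)) mem_imset //; exact: lift_inj.
by move=> I iI; rewrite liftKset finset.setD1K.
Qed.

(** The factor T_i of the product described at the top: the subsets avoiding i
contribute N in slot i, and those containing i contribute one more outer N and
a sign. *)
Lemma partialN_insert n (F : ('I_n.+1 -> V) -> V) x (i : 'I_n.+1) :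
  partialN_fun N F x =
  partialN_fun N (fun y => F (insert i (N (x i)) y) - N (F (insert i (x i) y)))
    (fun k => x (lift i k)).
Proof.
have iNlift (J : {set 'I_n}) : i \notin lift i @: J.
  by apply/imsetP => -[k' _ /eqP]; rewrite (negbTE (neq_lift _ _)).
rewrite !partialNE (big_set_lift i); apply: eq_bigr => J _.
rewrite cardsU1 iNlift card_imset; last exact: lift_inj.
rewrite add1n iterSr exprS mulN1r scaleNr -scalerBr; congr (_ *: _).
rewrite -[- iter _ _ _]scaleN1r.
have := iter_linear (linearP N) #|J| (-1)
  (N (F (apply_off (i |: lift i @: J) x))) (F (apply_off (lift i @: J) x)).
rewrite addrC => <-; congr (iter _ _ _); rewrite scaleN1r addrC.
congr (F _ - N (F _)); apply/funext => k; rewrite /apply_off.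
  case: (unliftP i k) => [k' ->|->].
    by rewrite insert_lift mem_imset //; exact: lift_inj.
  by rewrite insert_id (negbTE (iNlift J)).
case: (unliftP i k) => [k' ->|->].
  rewrite insert_lift !inE eq_sym (negbTE (neq_lift _ _)) mem_imset //.
  exact: lift_inj.
by rewrite insert_id finset.setU11.
Qed.

Lemma partialN_comp n (p : {linear V -> V}) (f : ('I_n -> V) -> V) x :
  (forall v, p (N v) = N (p v)) ->
  partialN_fun N (p \o f) x = p (partialN_fun N f x).
Proof.
move=> pN; rewrite !partialNE (GRing.linear_sum p); apply: eq_bigr => I _.
rewrite (linearZ_LR p) /=; congr (_ *: _).
by elim: #|I| => //= k ->.
Qed.

Lemma partialNB n (f h : ('I_n -> V) -> V) x :
  partialN_fun N (fun y => f y - h y) x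
  = partialN_fun N f x - partialN_fun N h x.
Proof.
have := partialN_linear (linearP N) x (-1) h f.
rewrite !scaleN1r => hf; rewrite [RHS]addrC -hf.
by congr (partialN_fun N _ x); apply/funext => y; rewrite addrC.
Qed.

Lemma partialNZ n c (f : ('I_n -> V) -> V) x :
  partialN_fun N (fun y => c *: f y) x = c *: partialN_fun N f x.
Proof.
have := partialN_linear (linearP N) x c f 0.
by rewrite addr0 (linear_map0 (partialN_linear (linearP N) x)) addr0.
Qed.

Lemma partialND n (f h : ('I_n -> V) -> V) x :
  partialN_fun N (fun y => f y + h y) x
  = partialN_fun N f x + partialN_fun N h x.
Proof.
by have := partialN_linear (linearP N) x 1 f h; rewrite !scale1r.
Qed.

Lemma partialN_sum n (I : finType) (P : pred I) (F : I -> ('I_n -> V) -> V) x :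
  partialN_fun N (fun y => \sum_(i | P i) F i y) x =
  \sum_(i | P i) partialN_fun N (F i) x.
Proof.
rewrite partialNE; under [RHS]eq_bigr do rewrite partialNE.
rewrite exchange_big; apply: eq_bigr => J _ /=.
by rewrite (big_morph (iter _ N) (iter_linearD _)
  (linear_map0 (iter_linear (linearP N) _))) scaler_sumr.
Qed.

End PartialN.

(** * Compatibility of partial^N with the differentials *)

Section PartialLie.
Variables (K : fieldType) (g : lieAlgType K) (N : {linear g -> g}).
Hypothesis hN : nijenhuis N.

(** After slot i is split off, f is followed by v |-> [N x_i, v] - N [x_i, v],
which commutes with N by the Nijenhuis identity and therefore passes through
the remaining factors. *)
Lemma partialN_action n (f : ('I_n -> g) -> g) x (i : 'I_n.+1) :
  partialN_fun N
    (fun y : 'I_n.+1 -> g => lie (y i) (f (fun k => y (lift i k)))) x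
  = lie (N (x i)) (partialN_fun N f (fun k => x (lift i k)))
    - N (lie (x i) (partialN_fun N f (fun k => x (lift i k)))).
Proof.
pose p : {linear g -> g} := lie (N (x i)) \- (N \o lie (x i)).
have pN v : p (N v) = N (p v).
  rewrite /p /= hN /lie_deformed linearB linearD linearB /=; zmod.
rewrite (partialN_insert _ _ _ i) -[RHS](partialN_comp f _ pN).
congr (partialN_fun N _ _); apply/funext => y; rewrite /p /= !insert_id.
have insi a : (fun k => insert i a y (lift i k)) = y.
  by apply/funext => k; rewrite insert_lift.
by rewrite !insi.
Qed.

(** On the left the slots i and j are split off, on the right the first slot of
f.  Both sides then are partial^N, over the remaining slots, of
f([N x_i, N x_j], ...) - N f([N x_i, x_j] + [x_i, N x_j], ...)
+ N (N f([x_i, x_j], ...)); on the right the terms f(N [x_i, x_j], ...)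
cancel. *)
Lemma partialN_bracket n (f : ('I_n.+1 -> g) -> g) x (i j : 'I_n.+2) :
  multilinear f -> (i < j)%N ->
  partialN_fun N (fun y : 'I_n.+2 -> g =>
    f (fcons (lie (y i) (y j)) (fun k => y (lift j (lift (inord i) k))))) x
  = partialN_fun N f (fcons (lie_deformed N (x i) (x j))
                       (fun k => x (lift j (lift (inord i) k))))
    - N (partialN_fun N f (fcons (lie (x i) (x j))
                       (fun k => x (lift j (lift (inord i) k))))).
Proof.
move=> fm ij.
have iE : lift j (inord i) = i.
  apply: val_inj; rewrite /= /bump inordK; last first.
    by rewrite (leq_trans ij) // -ltnS ltn_ord.
  by rewrite leqNgt ij.
rewrite (partialN_insert _ _ _ j) (partialN_insert _ _ _ (inord i)) iE.
rewrite !(partialN_insert _ f _ ord0) -!insert_ord0 !insert_id.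
have insS a y : (fun k => insert ord0 a y (lift ord0 k)) = y :> ('I_n -> g).
  by apply/funext => k; rewrite insert_lift.
rewrite !insS -(partialN_comp _ (p := N)) // -partialNB.
congr (partialN_fun N _ _); apply/funext => z.
have ins2 a b : (fun k =>
    insert j a (insert (inord i) b z) (lift j (lift (inord i) k))) = z.
  by apply/funext => k; rewrite !insert_lift.
have insi a b : insert j a (insert (inord i) b z) i = b.
  by rewrite -{2}iE insert_lift insert_id.
rewrite !insi !ins2 !insert_id /= -hN.
have fD u v :
    f (insert ord0 (u + v) z) = f (insert ord0 u z) + f (insert ord0 v z).
  by rewrite !insert_ord0 fcons_upd0 multilinearD // -!fcons_upd0.
have fN u : f (insert ord0 (- u) z) = - f (insert ord0 u z).
  apply/eqP; rewrite -subr_eq0 opprK -fD addNr insert_ord0 fcons_upd0.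
  by rewrite (linear_map0 (fm _ _)).
rewrite [in RHS]/lie_deformed !fD fN !linearB !linearD /= linearN; zmod.
Qed.

Lemma dN_partialN n (f : ('I_n.+1 -> g) -> g) : multilinear f ->
  dN_fun N (partialN_fun N f) = partialN_fun N (ce_fun f).
Proof.
move=> fm; apply/funext => x.
rewrite /dN_fun /ce_fun /ce_formula linearD !GRing.linear_sum.
rewrite opprD addrACA -!sumrB.
rewrite partialND !partialN_sum; congr (_ + _); apply: eq_bigr => i _.
  by rewrite partialNZ partialN_action linearZ_LR -scalerBr.
rewrite GRing.linear_sum -sumrB partialN_sum; apply: eq_bigr => j ij.
by rewrite partialNZ partialN_bracket // linearZ_LR -scalerBr.
Qed.

End PartialLie.

Theorem proposition3p11 (K : fieldType) (g : lieAlgType K)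
    (N : {linear g -> g}) (hN : nijenhuis N)
    (n : nat) (c : NLie_cochain g n) :
  delta_NLie N (delta_NLie N c) = 0.
Proof.
have ceK m (f : altHom g m.+1) : delta_CE (delta_CE f) = 0.
  apply/val_inj => /=; have [fm fa] := alt_predP _ (alt_funP f).
  exact: ce_lieK.
have dK m (f : altHom g m.+1) : d_N N (d_N N f) = 0.
  apply/val_inj => /=; have [fm fa] := alt_predP _ (alt_funP f).
  exact: dN_funK.
have dP m (f : altHom g m.+1) :
    d_N N (partial_N N f) = partial_N N (delta_CE f).
  apply/val_inj => /=; have [fm _] := alt_predP _ (alt_funP f).
  exact: dN_partialN.
case: n c => [|[|n]] c.
- have -> : delta_NLie N c = 0 by [].
  exact: linear0.
- congr (_, _); first exact: ceK.
  by rewrite /= linearN /= dP expr2 mulrNN mulr1 scale1r addNr.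
- congr (_, _); first exact: ceK.
  rewrite /= linearD /= dK add0r linearZ_LR /= dP.
  by rewrite [in X in _ + X]exprS mulN1r scaleNr subrr.
Qed.
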